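(* Let $\mathcal{E}$ be a category with finite limits and an interval $d_0,d_1:1\rightrightarrows \mathbf{I}$, and let $\mathsf{t}:\dot{\mathsf{T}}\to\mathsf{T}$ be a natural model in $\mathcal{E}$ such that (A1) $\mathsf{t}$ has path types, and (A2) $\mathsf{t}$ is a normal Hurewicz fibration. Then for every map $A\to X$ in $\mathcal{E}$ that is classified by $\mathsf{t}$, the relative pathobject factorization $$A\xrightarrow{\ \rho\ } P_X(A)\xrightarrow{\ \varepsilon\ } A\times_X A$$ of the diagonal validates the rules of intensional identity types, that is: (i) (formation and introduction) the map $\varepsilon:P_X(A)\to A\times_X A$ is classified by $\mathsf{t}$, and $\varepsilon\circ\rho$ is the diagonal $\delta:A\to A\times_X A$; (ii) (elimination and computation) for every map $\pi:C\to P_X(A)$ classified by $\mathsf{t}$ and every map $c:A\to C$ with $\pi\circ c=\rho$, there is a map $j:P_X(A)\to C$ with $\pi\circ j=\mathrm{id}_{P_X(A)}$ and $j\circ\rho=c$.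
   Context: An interval in a finite limit category $\mathcal{E}$ is an exponentiable object $\mathbf{I}$ with two points $d_0,d_1:1\rightrightarrows\mathbf{I}$ (no further conditions). For an object $A$, put $\rho=A^{!}:A\to A^{\mathbf{I}}$ (induced by $!:\mathbf{I}\to 1$) and $\varepsilon_i=A^{d_i}:A^{\mathbf{I}}\to A$ for $i=0,1$. Relative pathobject: for a map $A\to X$, regarded as an object of the slice $\mathcal{E}/X$, let $P_X(A)$ (over $X$) be the exponential in $\mathcal{E}/X$ of $A\to X$ by the pulled-back interval $X\times\mathbf{I}\to X$. Exponentiating $A\to X$ in $\mathcal{E}/X$ by the projection $X\times\mathbf{I}\to X$ (the map to the terminal object of $\mathcal{E}/X$) and by the two points $X\times d_0,\,X\times d_1:X\rightrightarrows X\times\mathbf{I}$ gives, respectively, the following maps over $X$: the reflexivity map $\rho:A\to P_X(A)$ and the endpoint maps $\varepsilon_0,\varepsilon_1:P_X(A)\to A$; put $\varepsilon=\langle\varepsilon_0,\varepsilon_1\rangle:P_X(A)\to A\times_X A$; the composite $\varepsilon\rho$ is the diagonal. A natural model in $\mathcal{E}$ is a map $\mathsf{t}:\dot{\mathsf{T}}\to\mathsf{T}$ (with chosen pullbacks along all maps into $\mathsf{T}$). A map $A\to X$ is classified by $\mathsf{t}$ if it is a pullback of $\mathsf{t}$ along some map $X\to\mathsf{T}$. (A1) $\mathsf{t}$ has path types if there are maps $\mathsf{Path}:\dot{\mathsf{T}}\times_{\mathsf{T}}\dot{\mathsf{T}}\to\mathsf{T}$ and $\mathsf{path}:P_{\mathsf{T}}(\dot{\mathsf{T}})\to\dot{\mathsf{T}}$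 such that $\mathsf{t}\circ\mathsf{path}=\mathsf{Path}\circ\varepsilon$ and this square is a pullback, where $\varepsilon:P_{\mathsf{T}}(\dot{\mathsf{T}})\to\dot{\mathsf{T}}\times_{\mathsf{T}}\dot{\mathsf{T}}$ is the relative pathobject of $\mathsf{t}$ over $\mathsf{T}$. (A2) A map $f:Y\to X$ is a Hurewicz fibration if the comparison map $\langle f^{\mathbf{I}},\varepsilon_0\rangle:Y^{\mathbf{I}}\to X^{\mathbf{I}}\times_X Y$ (the pullback being that of $\varepsilon_0:X^{\mathbf{I}}\to X$ and $f$) has a section $\ell:X^{\mathbf{I}}\times_X Y\to Y^{\mathbf{I}}$. It is normal if it comes with such a section $\ell$ satisfying in addition $\ell\circ(\rho\times_X Y)=\rho\circ p_2: X\times_X Y\to Y^{\mathbf{I}}$, where $p_2:X\times_X Y\cong Y$ is the projection (i.e. lifts of constant paths are constant). *)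

(* Defs.v *)
From Stdlib Require Import ProofIrrelevance.

Set Implicit Arguments.
Unset Strict Implicit.
Unset Printing Implicit Defensive.

Declare Scope cat_scope.
Open Scope cat_scope.

Record category := Category {
  Ob :> Type;
  Hom : Ob -> Ob -> Type;
  idm : forall A : Ob, Hom A A;
  comp : forall A B C : Ob, Hom B C -> Hom A B -> Hom A C;
  compIl : forall (A B : Ob) (f : Hom A B), comp (idm B) f = f;
  compIr : forall (A B : Ob) (f : Hom A B), comp f (idm A) = f;
  compA : forall (A B C D : Ob) (h : Hom C D) (g : Hom B C) (f : Hom A B),
    comp h (comp g f) = comp (comp h g) f }.

Arguments idm {c} A.

Notation "A ~> B" := (Hom A B) (at level 90, right associativity) : cat_scope.
Notation "g ∘ f" := (comp g f) (at level 40, left associativity) : cat_scope.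

(** Limits are given by chosen cones together with their mediating maps. *)

Record terminal (C : category) := Terminal {
  ter_obj :> C;
  bang : forall A : C, A ~> ter_obj;
  bang_uniq : forall (A : C) (f g : A ~> ter_obj), f = g }.

Record product (C : category) (A B : C) := Product {
  prod_obj :> C;
  pr1 : prod_obj ~> A;
  pr2 : prod_obj ~> B;
  pair : forall Z : C, (Z ~> A) -> (Z ~> B) -> (Z ~> prod_obj);
  pr1_pair : forall (Z : C) (f : Z ~> A) (g : Z ~> B), pr1 ∘ pair f g = f;
  pr2_pair : forall (Z : C) (f : Z ~> A) (g : Z ~> B), pr2 ∘ pair f g = g;
  pair_uniq : forall (Z : C) (m m' : Z ~> prod_obj),
    pr1 ∘ m = pr1 ∘ m' -> pr2 ∘ m = pr2 ∘ m' -> m = m' }.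

Record pullback (C : category) (X Y Z : C) (f : X ~> Z) (g : Y ~> Z) := Pullback {
  pb_obj :> C;
  pb1 : pb_obj ~> X;
  pb2 : pb_obj ~> Y;
  pb_eq : f ∘ pb1 = g ∘ pb2;
  pb_pair : forall (W : C) (h : W ~> X) (k : W ~> Y),
    f ∘ h = g ∘ k -> (W ~> pb_obj);
  pb1_pair : forall (W : C) (h : W ~> X) (k : W ~> Y) (e : f ∘ h = g ∘ k),
    pb1 ∘ pb_pair e = h;
  pb2_pair : forall (W : C) (h : W ~> X) (k : W ~> Y) (e : f ∘ h = g ∘ k),
    pb2 ∘ pb_pair e = k;
  pb_uniq : forall (W : C) (m m' : W ~> pb_obj),
    pb1 ∘ m = pb1 ∘ m' -> pb2 ∘ m = pb2 ∘ m' -> m = m' }.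

Definition is_pullback (C : category) (P X Y Z : C)
    (f : X ~> Z) (g : Y ~> Z) (p : P ~> X) (q : P ~> Y) : Prop :=
  f ∘ p = g ∘ q /\
  forall (W : C) (h : W ~> X) (k : W ~> Y), f ∘ h = g ∘ k ->
    exists! m : W ~> P, p ∘ m = h /\ q ∘ m = k.

Record finite_products (C : category) := FiniteProducts {
  one : terminal C;
  times : forall A B : C, product A B }.

(** Binary products are definable from a terminal object and pullbacks; they
    are part of the chosen structure for convenience only. *)
Record finite_limits (C : category) := FiniteLimits {
  fl_products :> finite_products C;
  pb : forall (X Y Z : C) (f : X ~> Z) (g : Y ~> Z), pullback f g }.

(** Only finite products are used here, so that everything applies to a category
    with finite limits as well as to each of its slices. *)

Section Exponentials.

Variables (C : category) (FP : finite_products C).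

Definition prod_map (A A' B B' : C) (f : A ~> A') (g : B ~> B') :
    times FP A B ~> times FP A' B' :=
  pair (times FP A' B') (f ∘ pr1 (times FP A B)) (g ∘ pr2 (times FP A B)).

Record exponential (I A : C) := Exponential {
  exp_obj :> C;
  ev : times FP exp_obj I ~> A;
  curry : forall Z : C, (times FP Z I ~> A) -> (Z ~> exp_obj);
  ev_curry : forall (Z : C) (h : times FP Z I ~> A),
    ev ∘ prod_map (curry h) (idm I) = h;
  curry_uniq : forall (Z : C) (m m' : Z ~> exp_obj),
    ev ∘ prod_map m (idm I) = ev ∘ prod_map m' (idm I) -> m = m' }.

Lemma prod_map_pair (Z A A' B B' : C) (f : A ~> A') (g : B ~> B')
    (a : Z ~> A) (b : Z ~> B) :
  prod_map f g ∘ pair (times FP A B) a b = pair (times FP A' B') (f ∘ a) (g ∘ b).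
Proof.
apply pair_uniq; unfold prod_map.
- now rewrite compA, !pr1_pair, <- compA, pr1_pair.
- now rewrite compA, !pr2_pair, <- compA, pr2_pair.
Qed.

Lemma prod_map_comp (A A' A'' B B' B'' : C) (f : A ~> A') (f' : A' ~> A'')
    (g : B ~> B') (g' : B' ~> B'') :
  prod_map f' g' ∘ prod_map f g = prod_map (f' ∘ f) (g' ∘ g).
Proof.
unfold prod_map at 2.
rewrite prod_map_pair; unfold prod_map.
now rewrite !compA.
Qed.

(** [exp_pre u] is the map [A^u : A^I ~> A^J], for [u : J ~> I]. *)
Definition exp_pre (I J A : C) (u : J ~> I)
    (AI : exponential I A) (AJ : exponential J A) : AI ~> AJ :=
  curry AJ (ev AI ∘ prod_map (idm AI) u).

(** [exp_post f] is the map [f^I : Y^I ~> X^I], for [f : Y ~> X]. *)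
Definition exp_post (I X Y : C) (f : Y ~> X)
    (YI : exponential I Y) (XI : exponential I X) : YI ~> XI :=
  curry XI (f ∘ ev YI).

Lemma exp_pre_id (I A : C) (AI : exponential I A) :
  exp_pre (idm I) AI AI = idm (AI : C).
Proof. apply curry_uniq; unfold exp_pre; now rewrite ev_curry. Qed.

Lemma exp_pre_comp (I J K A : C) (u : J ~> I) (v : K ~> J)
    (AI : exponential I A) (AJ : exponential J A) (AK : exponential K A) :
  exp_pre v AJ AK ∘ exp_pre u AI AJ = exp_pre (u ∘ v) AI AK.
Proof.
apply curry_uniq; unfold exp_pre.
rewrite ev_curry.
set (k := curry AJ (ev AI ∘ prod_map (idm AI) u)).
assert (E : forall c : AJ ~> AK, prod_map (c ∘ k) (idm K)
              = prod_map c (idm K) ∘ prod_map k (idm K))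
  by (intro c; now rewrite prod_map_comp, compIl).
rewrite E, compA, ev_curry, <- compA, prod_map_comp, compIl, compIr.
assert (E' : prod_map k v = prod_map k (idm J) ∘ prod_map (idm AI) v)
  by (now rewrite prod_map_comp, compIl, compIr).
rewrite E', compA; unfold k; rewrite ev_curry.
now rewrite <- compA, prod_map_comp, compIl.
Qed.

Lemma exp_pre_post (I J X Y : C) (u : J ~> I) (f : Y ~> X)
    (YI : exponential I Y) (YJ : exponential J Y)
    (XI : exponential I X) (XJ : exponential J X) :
  exp_pre u XI XJ ∘ exp_post f YI XI = exp_post f YJ XJ ∘ exp_pre u YI YJ.
Proof.
apply curry_uniq; unfold exp_pre, exp_post.
set (k := curry XI (f ∘ ev YI)).
set (k' := curry YJ (ev YI ∘ prod_map (idm YI) u)).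
assert (E1 : forall c : XI ~> XJ, prod_map (c ∘ k) (idm J)
               = prod_map c (idm J) ∘ prod_map k (idm J))
  by (intro c; now rewrite prod_map_comp, compIl).
assert (E2 : forall c : YJ ~> XJ, prod_map (c ∘ k') (idm J)
               = prod_map c (idm J) ∘ prod_map k' (idm J))
  by (intro c; now rewrite prod_map_comp, compIl).
rewrite E1, E2, !compA, !ev_curry.
rewrite <- compA, prod_map_comp, compIl, compIr.
rewrite <- (compA f (ev YJ)); unfold k'; rewrite ev_curry.
rewrite compA, <- (ev_curry XI (f ∘ ev YI)); fold k.
now rewrite <- compA, prod_map_comp, compIl, compIr.
Qed.

(** The isomorphism [A^1 = A], as an exponential of [A] by [1] with object [A]. *)
Lemma exp_one_ev_curry (A Z : C) (h : times FP Z (one FP) ~> A) :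
  pr1 (times FP A (one FP))
    ∘ prod_map (h ∘ pair (times FP Z (one FP)) (idm Z) (bang (one FP) Z))
        (idm (one FP)) = h.
Proof.
unfold prod_map; rewrite pr1_pair, <- compA.
assert (E : pair (times FP Z (one FP)) (idm Z) (bang (one FP) Z)
              ∘ pr1 (times FP Z (one FP)) = idm _).
{ apply pair_uniq; [|apply bang_uniq].
  now rewrite compA, pr1_pair, compIl, compIr. }
now rewrite E, compIr.
Qed.

Lemma exp_one_curry_uniq (A Z : C) (m m' : Z ~> A) :
  pr1 (times FP A (one FP)) ∘ prod_map m (idm (one FP)) =
  pr1 (times FP A (one FP)) ∘ prod_map m' (idm (one FP)) -> m = m'.
Proof.
unfold prod_map; rewrite !pr1_pair; intro E.
apply (f_equal (fun k => k ∘ pair (times FP Z (one FP)) (idm Z) (bang (one FP) Z)))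
  in E.
now rewrite <- !compA, !pr1_pair, !compIr in E.
Qed.

Definition exp_one (A : C) : exponential (one FP) A :=
  Exponential (exp_one_ev_curry (A := A)) (exp_one_curry_uniq (A := A)).

Record interval := Interval {
  itv :> C;
  d0 : one FP ~> itv;
  d1 : one FP ~> itv;
  itv_exp : forall A : C, exponential itv A }.

Variable I : interval.

Definition path_obj (A : C) : C := itv_exp I A.

Definition path_map (Y X : C) (f : Y ~> X) : path_obj Y ~> path_obj X :=
  exp_post f (itv_exp I Y) (itv_exp I X).

(** [exp_one A] identifies [A^1] with [A], so that [refl], [eps0] and [eps1] are
    the maps [A^!], [A^d0] and [A^d1]. *)
Definition refl (A : C) : A ~> path_obj A :=
  exp_pre (bang (one FP) I) (exp_one A) (itv_exp I A).

Definition eps0 (A : C) : path_obj A ~> A :=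
  exp_pre (d0 I) (itv_exp I A) (exp_one A).

Definition eps1 (A : C) : path_obj A ~> A :=
  exp_pre (d1 I) (itv_exp I A) (exp_one A).

Definition endpoints (A : C) : path_obj A ~> times FP A A :=
  pair (times FP A A) (eps0 A) (eps1 A).

Lemma exp_post_one (X Y : C) (f : Y ~> X) :
  exp_post f (exp_one Y) (exp_one X) = f.
Proof.
unfold exp_post; cbn.
now rewrite <- compA, pr1_pair, compIr.
Qed.

Lemma eps0_nat (X Y : C) (f : Y ~> X) : eps0 X ∘ path_map f = f ∘ eps0 Y.
Proof.
refine (eq_trans (exp_pre_post (d0 I) f _ (exp_one Y) _ (exp_one X)) _).
now rewrite exp_post_one.
Qed.

Lemma refl_nat (X Y : C) (f : Y ~> X) : refl X ∘ f = path_map f ∘ refl Y.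
Proof.
refine (eq_trans _ (exp_pre_post (bang (one FP) I) f (exp_one Y) _ (exp_one X) _)).
now rewrite exp_post_one.
Qed.

Lemma eps0_refl (A : C) : eps0 A ∘ refl A = idm A.
Proof.
refine (eq_trans (exp_pre_comp (bang (one FP) I) (d0 I)
  (exp_one A) (itv_exp I A) (exp_one A)) _).
rewrite (bang_uniq _ (idm (one FP))).
exact (exp_pre_id (exp_one A)).
Qed.

End Exponentials.

Section Slice.

Variables (E : category) (X : E).

Record slice_ob := SliceOb { sl_dom : E; sl_map : sl_dom ~> X }.

Record slice_hom (A B : slice_ob) := SliceHom {
  sl_fun : sl_dom A ~> sl_dom B;
  sl_tri : sl_map B ∘ sl_fun = sl_map A }.

Lemma slice_hom_eq (A B : slice_ob) (f g : slice_hom A B) :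
  sl_fun f = sl_fun g -> f = g.
Proof.
destruct f as [f e], g as [g e']; cbn; intros <-.
now rewrite (proof_irrelevance _ e e').
Qed.

Definition slice_id (A : slice_ob) : slice_hom A A :=
  SliceHom (compIr (sl_map A)).

Lemma slice_comp_tri (A B D : slice_ob) (g : slice_hom B D) (f : slice_hom A B) :
  sl_map D ∘ (sl_fun g ∘ sl_fun f) = sl_map A.
Proof. now rewrite compA, !sl_tri. Qed.

Definition slice_comp (A B D : slice_ob) (g : slice_hom B D) (f : slice_hom A B) :
    slice_hom A D :=
  SliceHom (slice_comp_tri g f).

Lemma slice_compIl (A B : slice_ob) (f : slice_hom A B) :
  slice_comp (slice_id B) f = f.
Proof. apply slice_hom_eq, compIl. Qed.

Lemma slice_compIr (A B : slice_ob) (f : slice_hom A B) :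
  slice_comp f (slice_id A) = f.
Proof. apply slice_hom_eq, compIr. Qed.

Lemma slice_compA (A B D F : slice_ob) (h : slice_hom D F) (g : slice_hom B D)
    (f : slice_hom A B) :
  slice_comp h (slice_comp g f) = slice_comp (slice_comp h g) f.
Proof. apply slice_hom_eq, compA. Qed.

Definition slice : category :=
  Category slice_compIl slice_compIr slice_compA.

End Slice.

Section SliceProducts.

Variables (E : category) (FL : finite_limits E) (X : E).

Definition slice_one_obj : slice X := SliceOb (idm X).

Definition slice_bang (A : slice X) : A ~> slice_one_obj :=
  @SliceHom E X A slice_one_obj (sl_map A) (compIl (sl_map A)).

Lemma slice_bang_uniq (A : slice X) (f g : A ~> slice_one_obj) : f = g.
Proof.
apply slice_hom_eq.
rewrite <- (compIl (sl_fun f)), <- (compIl (sl_fun g)).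
exact (eq_trans (sl_tri f) (eq_sym (sl_tri g))).
Qed.

Definition slice_one : terminal (slice X) := Terminal slice_bang slice_bang_uniq.

Section Product.

Variables A B : slice X.

Let P : pullback (sl_map A) (sl_map B) := pb FL (sl_map A) (sl_map B).

Definition slice_prod_obj : slice X := SliceOb (sl_map A ∘ pb1 P).

Definition slice_pr1 : slice_prod_obj ~> A :=
  @SliceHom E X slice_prod_obj A (pb1 P) eq_refl.

Definition slice_pr2 : slice_prod_obj ~> B :=
  @SliceHom E X slice_prod_obj B (pb2 P) (eq_sym (pb_eq P)).

Lemma slice_pair_eq (Z : slice X) (f : Z ~> A) (g : Z ~> B) :
  sl_map A ∘ sl_fun f = sl_map B ∘ sl_fun g.
Proof. now rewrite !sl_tri. Qed.

Lemma slice_pair_tri (Z : slice X) (f : Z ~> A) (g : Z ~> B) :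
  sl_map A ∘ pb1 P ∘ pb_pair P (slice_pair_eq f g) = sl_map Z.
Proof. now rewrite <- compA, pb1_pair, sl_tri. Qed.

Definition slice_pair (Z : slice X) (f : Z ~> A) (g : Z ~> B) :
    Z ~> slice_prod_obj :=
  @SliceHom E X Z slice_prod_obj _ (slice_pair_tri f g).

Lemma slice_pr1_pair (Z : slice X) (f : Z ~> A) (g : Z ~> B) :
  slice_pr1 ∘ slice_pair f g = f.
Proof. apply slice_hom_eq, pb1_pair. Qed.

Lemma slice_pr2_pair (Z : slice X) (f : Z ~> A) (g : Z ~> B) :
  slice_pr2 ∘ slice_pair f g = g.
Proof. apply slice_hom_eq, pb2_pair. Qed.

Lemma slice_pair_uniq (Z : slice X) (m m' : Z ~> slice_prod_obj) :
  slice_pr1 ∘ m = slice_pr1 ∘ m' -> slice_pr2 ∘ m = slice_pr2 ∘ m' -> m = m'.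
Proof.
intros e1 e2; apply slice_hom_eq, (pb_uniq (p := P)).
- exact (f_equal (@sl_fun _ _ _ _) e1).
- exact (f_equal (@sl_fun _ _ _ _) e2).
Qed.

Definition slice_prod : product A B :=
  Product slice_pr1_pair slice_pr2_pair slice_pair_uniq.

End Product.

Definition slice_products : finite_products (slice X) :=
  FiniteProducts slice_one slice_prod.

End SliceProducts.

Section SliceInterval.

Variables (E : category) (FL : finite_limits E) (I : interval FL) (X : E).

Let XI : product X I := times FL X I.

Definition slice_itv_obj : slice X := SliceOb (pr1 XI).

(** The point [X * d] of the pulled-back interval; the terminal object of the
    slice is [idm X], so [X * 1] is replaced by [X]. *)
Definition slice_point (d : one FL ~> I) :
    one (slice_products FL X) ~> slice_itv_obj :=
  @SliceHom E X (slice_one_obj X) slice_itv_obj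
    (pair XI (idm X) (d ∘ bang (one FL) X))
    (pr1_pair XI (idm X) (d ∘ bang (one FL) X)).

Section Exponential.

Variable A : slice X.

Let a : sl_dom A ~> X := sl_map A.

(** The exponential of [a : A ~> X] by [X * I ~> X] is the pullback of
    [a^I : A^I ~> X^I] along [refl X : X ~> X^I]. *)
Let P : pullback (path_map I a) (refl I X) := pb FL (path_map I a) (refl I X).

Definition slice_exp_obj : slice X := SliceOb (pb2 P).

Let PX (Z : slice X) : pullback (sl_map Z) (pr1 XI) := pb FL (sl_map Z) (pr1 XI).

Definition slice_ev_fun :
    sl_dom (slice_prod_obj FL slice_exp_obj slice_itv_obj) ~> sl_dom A :=
  ev (itv_exp I (sl_dom A)) ∘ pair (times FL (path_obj I (sl_dom A)) I)
    (pb1 P ∘ pb1 (PX slice_exp_obj)) (pr2 XI ∘ pb2 (PX slice_exp_obj)).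

Lemma ev_path_map (Y Y' Z : E) (f : Y ~> Y') (h : Z ~> path_obj I Y) (k : Z ~> I) :
  f ∘ (ev (itv_exp I Y) ∘ pair (times FL (path_obj I Y) I) h k) =
  ev (itv_exp I Y') ∘ pair (times FL (path_obj I Y') I) (path_map I f ∘ h) k.
Proof.
rewrite compA, <- (ev_curry (itv_exp I Y') (f ∘ ev (itv_exp I Y))), <- compA.
rewrite prod_map_pair, compIl.
reflexivity.
Qed.

Lemma ev_refl (Y Z : E) (h : Z ~> Y) (k : Z ~> I) :
  ev (itv_exp I Y) ∘ pair (times FL (path_obj I Y) I) (refl I Y ∘ h) k = h.
Proof.
assert (e : pair (times FL (path_obj I Y) I) (refl I Y ∘ h) k =
            prod_map FL (refl I Y) (idm I) ∘ pair (times FL Y I) h k)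
  by now rewrite prod_map_pair, compIl.
assert (e' : ev (itv_exp I Y) ∘ prod_map FL (refl I Y) (idm I) =
             pr1 (times FL Y (one FL)) ∘ prod_map FL (idm Y) (bang (one FL) I))
  by exact (ev_curry (itv_exp I Y) _).
unfold path_obj in *.
rewrite e, compA, e', <- compA, prod_map_pair, pr1_pair.
apply compIl.
Qed.

Lemma slice_ev_tri :
  sl_map A ∘ slice_ev_fun =
  sl_map (slice_prod_obj FL slice_exp_obj slice_itv_obj).
Proof.
unfold slice_ev_fun; rewrite ev_path_map, compA.
fold a; rewrite (pb_eq P), <- compA.
apply ev_refl.
Qed.

Definition slice_ev :
    times (slice_products FL X) slice_exp_obj slice_itv_obj ~> A :=
  @SliceHom E X (slice_prod_obj FL slice_exp_obj slice_itv_obj) A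
    slice_ev_fun slice_ev_tri.

Section Curry.

Variable Z : slice X.

Let z : sl_dom Z ~> X := sl_map Z.

Lemma slice_transpose_eq :
  z ∘ pr1 (times FL (sl_dom Z) I) =
  pr1 XI ∘ pair XI (z ∘ pr1 (times FL (sl_dom Z) I)) (pr2 (times FL (sl_dom Z) I)).
Proof. now rewrite pr1_pair. Qed.

(** The comparison [Z * I ~> Z *_X (X * I)]. *)
Definition slice_transpose : times FL (sl_dom Z) I ~> PX Z :=
  pb_pair (PX Z) slice_transpose_eq.

Variable h : times (slice_products FL X) Z slice_itv_obj ~> A.

Definition slice_curry_path : sl_dom Z ~> path_obj I (sl_dom A) :=
  curry (itv_exp I (sl_dom A)) (sl_fun h ∘ slice_transpose).

Lemma slice_curry_eq : path_map I a ∘ slice_curry_path = refl I X ∘ z.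
Proof.
apply (curry_uniq (e := itv_exp I X)); unfold prod_map at 1 2.
rewrite <- !compA.
rewrite <- ev_path_map, ev_refl.
assert (e : ev (itv_exp I (sl_dom A))
             ∘ pair (times FL (path_obj I (sl_dom A)) I)
                 (slice_curry_path ∘ pr1 (times FL (sl_dom Z) I))
                 (idm I ∘ pr2 (times FL (sl_dom Z) I))
           = sl_fun h ∘ slice_transpose)
  by exact (ev_curry (itv_exp I (sl_dom A)) (sl_fun h ∘ slice_transpose)).
rewrite e, compA; unfold a; rewrite (sl_tri h); cbn.
rewrite <- compA; unfold slice_transpose; now rewrite pb1_pair.
Qed.

Lemma slice_curry_tri : pb2 P ∘ pb_pair P slice_curry_eq = sl_map Z.
Proof. apply pb2_pair. Qed.

Definition slice_curry : Z ~> slice_exp_obj :=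
  @SliceHom E X Z slice_exp_obj _ slice_curry_tri.

End Curry.

Lemma slice_transpose_section (Z : slice X) :
  slice_transpose Z ∘ pair (times FL (sl_dom Z) I)
    (pb1 (PX Z)) (pr2 XI ∘ pb2 (PX Z)) = idm (PX Z : E).
Proof.
unfold slice_transpose; apply (pb_uniq (p := PX Z)); rewrite compA, compIr.
- now rewrite pb1_pair, pr1_pair.
- rewrite pb2_pair; apply pair_uniq; rewrite compA.
  + now rewrite pr1_pair, <- compA, pr1_pair, (pb_eq (PX Z)).
  + now rewrite pr2_pair, pr2_pair.
Qed.

Lemma slice_ev_prod_map (Z : slice X) (m : Z ~> slice_exp_obj) :
  sl_fun (slice_ev ∘ prod_map (slice_products FL X) m (idm slice_itv_obj)) =
  ev (itv_exp I (sl_dom A)) ∘ prod_map FL (pb1 P ∘ sl_fun m) (idm I)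
    ∘ pair (times FL (sl_dom Z) I) (pb1 (PX Z)) (pr2 XI ∘ pb2 (PX Z)).
Proof.
rewrite <- compA, prod_map_pair, compIl.
cbn; unfold slice_ev_fun.
rewrite <- compA.
apply (f_equal (comp (ev (itv_exp I (sl_dom A))))).
apply pair_uniq; rewrite compA.
- rewrite !pr1_pair, <- !compA.
  apply (f_equal (comp (pb1 P))).
  unfold PX; now rewrite pb1_pair.
- rewrite !pr2_pair, <- !compA.
  apply (f_equal (comp (pr2 XI))).
  unfold PX; rewrite pb2_pair; cbn; apply compIl.
Qed.

Lemma slice_ev_curry (Z : slice X)
    (h : times (slice_products FL X) Z slice_itv_obj ~> A) :
  slice_ev ∘ prod_map (slice_products FL X) (slice_curry h) (idm slice_itv_obj) = h.
Proof.
apply slice_hom_eq; rewrite slice_ev_prod_map.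
unfold slice_curry; cbn; rewrite pb1_pair; unfold slice_curry_path.
rewrite ev_curry, <- compA, slice_transpose_section; apply compIr.
Qed.

Lemma slice_transpose_retraction (Z : slice X) :
  pair (times FL (sl_dom Z) I) (pb1 (PX Z)) (pr2 XI ∘ pb2 (PX Z))
    ∘ slice_transpose Z = idm (times FL (sl_dom Z) I : E).
Proof.
unfold slice_transpose; apply pair_uniq; rewrite compA, compIr.
- now rewrite pr1_pair, pb1_pair.
- now rewrite pr2_pair, <- compA, pb2_pair, pr2_pair.
Qed.

Lemma slice_curry_uniq (Z : slice X) (m m' : Z ~> slice_exp_obj) :
  slice_ev ∘ prod_map (slice_products FL X) m (idm slice_itv_obj) =
  slice_ev ∘ prod_map (slice_products FL X) m' (idm slice_itv_obj) -> m = m'.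
Proof.
intro e; apply (f_equal (fun k => sl_fun k)) in e.
rewrite !slice_ev_prod_map in e.
apply (f_equal (fun k => k ∘ slice_transpose Z)) in e.
rewrite <- !(compA _ _ (slice_transpose Z)), slice_transpose_retraction, !compIr in e.
apply slice_hom_eq, (pb_uniq (p := P)).
- exact (curry_uniq e).
- exact (eq_trans (sl_tri m) (eq_sym (sl_tri m'))).
Qed.

Definition slice_exp :
    exponential (slice_products FL X) slice_itv_obj A :=
  Exponential slice_ev_curry slice_curry_uniq.

End Exponential.

Definition slice_interval : interval (slice_products FL X) :=
  Interval (slice_point (d0 I)) (slice_point (d1 I)) slice_exp.

End SliceInterval.

Section RelativePath.

Variables (E : category) (FL : finite_limits E) (I : interval FL).
Variables (A X : E) (a : A ~> X).

Let S : interval (slice_products FL X) := slice_interval I X.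
Let A_X : slice X := SliceOb a.

(** The domain in [E] of the pathobject of [a] in the slice over [X]. *)
Definition rel_path : E := sl_dom (path_obj S A_X).

Definition rel_refl : A ~> rel_path := sl_fun (refl S A_X).

(** The product of [a] with itself in the slice is its chosen kernel pair in [E]. *)
Definition rel_endpoints : rel_path ~> pb FL a a := sl_fun (endpoints S A_X).

Definition rel_diag : A ~> pb FL a a :=
  pb_pair (pb FL a a) (eq_refl (a ∘ idm A)).

End RelativePath.

Record natural_model (E : category) := NaturalModel {
  nm_dom : E;
  nm_cod : E;
  nm_map :> nm_dom ~> nm_cod;
  nm_pb : forall (X : E) (b : X ~> nm_cod), pullback b nm_map }.

Definition classified (E : category) (t : natural_model E) (A X : E) (p : A ~> X) :
    Prop :=
  exists (b : X ~> nm_cod t) (q : A ~> nm_dom t), is_pullback b t p q.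

Section PathTypesAndLifting.

Variables (E : category) (FL : finite_limits E) (I : interval FL).

Definition has_path_types (t : natural_model E) : Prop :=
  exists (Path : pb FL (nm_map t) (nm_map t) ~> nm_cod t)
         (path : rel_path I (nm_map t) ~> nm_dom t),
    is_pullback Path t (rel_endpoints I (nm_map t)) path.

Variables (Y X : E) (f : Y ~> X).

(** The object [X^I *_X Y], formed with [eps0]. *)
Definition path_cocyl : pullback (eps0 I X) f := pb FL (eps0 I X) f.

Definition path_compar : path_obj I Y ~> path_cocyl :=
  pb_pair path_cocyl (eps0_nat I f).

Definition is_path_lifting (l : path_cocyl ~> path_obj I Y) : Prop :=
  path_compar ∘ l = idm (path_cocyl : E).

Definition hurewicz_fibration : Prop :=
  exists l : path_cocyl ~> path_obj I Y, is_path_lifting l.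

Lemma refl_times_eq :
  eps0 I X ∘ (refl I X ∘ pb1 (pb FL (idm X) f)) = f ∘ pb2 (pb FL (idm X) f).
Proof. now rewrite compA, eps0_refl, (pb_eq (pb FL (idm X) f)). Qed.

(** The map [refl *_X Y : X *_X Y ~> X^I *_X Y]. *)
Definition refl_times : pb FL (idm X) f ~> path_cocyl :=
  pb_pair path_cocyl refl_times_eq.

Definition normal_hurewicz_fibration : Prop :=
  exists l : path_cocyl ~> path_obj I Y,
    is_path_lifting l /\ l ∘ refl_times = refl I Y ∘ pb2 (pb FL (idm X) f).

End PathTypesAndLifting.

(* Main.v *)
Require Import Defs.

(** Give every classified map transport along paths, and contract each path onto
    the constant path at its source; eliminating at a path is then transport
    along its contraction.  The question is where the contraction comes from,
    since an arbitrary interval has no connections.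

    Let [e] be a path in a fiber of [p] from [x] to [y].  The map
    [i |-> (x, e i)] is a path in [A *_X A] that starts at the endpoints of the
    constant path at [x], and lifting it through the endpoint map gives a square
    [s i j] in the fiber with
    - [s 0 j = x], because the lift starts at the constant path;
    - [s i 0 = x] and [s i 1 = e i], because it lies over the given path.
    The last column [s 1 -] is some path from [x] to [y] which need not be [e], so
    the square as it stands is a path from the constant path at [x] to the
    wrong end.  But its transpose [j |-> s - j] goes from [s - 0], which is constant
    at [x], to [s - 1], which is [e] itself.  Thus [s] read in the other
    direction is the desired contraction, and it is constant when [e] is constant
    because the lifting is normal ([contraction]).

    Now let [pi : C ~> P_X(A)] be classified and [c] be a section of it over
    constant paths.  Lifting the contraction of [e] through [pi], starting from
    [c x], ends at a point over [e]; normality says that it ends at [c x] if [e]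
    is constant, which is the computation rule ([relative_elimination]).

    Two facts make this available for all classified maps.  Normal lifting is
    used in the form of [relative_lifting], which is stable under
    pullback ([relative_lifting_pullback]), so that it passes from [t] to
    every classified map; and the endpoint map of a classified map is itself
    classified, being a pullback of the endpoint map of [t]
    ([classified_rel_endpoints]). *)

Set Implicit Arguments.
Unset Strict Implicit.
Unset Printing Implicit Defensive.

(** * Cylinders and paths as maps out of them *)

Section Cylinders.

Variables (E : category) (FL : finite_limits E) (I : interval FL).

Local Notation cyl Z := (times FL Z I).

Definition cyl_map (W Z : E) (u : W ~> Z) : cyl W ~> cyl Z :=
  prod_map FL u (idm I).

Definition face (d : one FL ~> I) (Z : E) : Z ~> cyl Z :=
  pair (cyl Z) (idm Z) (d ∘ bang (one FL) Z).

Lemma pr1_face (d : one FL ~> I) (Z : E) : pr1 (cyl Z) ∘ face d Z = idm Z.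
Proof. apply pr1_pair. Qed.

Lemma pr1_cyl_map (W Z : E) (u : W ~> Z) :
  pr1 (cyl Z) ∘ cyl_map u = u ∘ pr1 (cyl W).
Proof. apply pr1_pair. Qed.

Lemma pr2_cyl_map (W Z : E) (u : W ~> Z) :
  pr2 (cyl Z) ∘ cyl_map u = pr2 (cyl W).
Proof. unfold cyl_map, prod_map; rewrite pr2_pair; apply compIl. Qed.

Lemma face_nat (d : one FL ~> I) (W Z : E) (u : W ~> Z) :
  cyl_map u ∘ face d W = face d Z ∘ u.
Proof.
apply pair_uniq; rewrite !compA.
- now rewrite pr1_cyl_map, <- compA, !pr1_face, compIl, compIr.
- rewrite pr2_cyl_map; unfold face; rewrite !pr2_pair, <- compA.
  apply f_equal, bang_uniq.
Qed.

Lemma cyl_map_comp (V W Z : E) (u : W ~> Z) (v : V ~> W) :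
  cyl_map (u ∘ v) = cyl_map u ∘ cyl_map v.
Proof. unfold cyl_map; now rewrite prod_map_comp, compIl. Qed.

Definition swap (Z : E) : cyl (cyl Z) ~> cyl (cyl Z) :=
  pair (cyl (cyl Z))
    (pair (cyl Z) (pr1 (cyl Z) ∘ pr1 (cyl (cyl Z))) (pr2 (cyl (cyl Z))))
    (pr2 (cyl Z) ∘ pr1 (cyl (cyl Z))).

Lemma swap_cyl_map_face (d : one FL ~> I) (Z : E) :
  swap Z ∘ cyl_map (face d Z) = face d (cyl Z).
Proof.
apply pair_uniq; rewrite !compA; unfold swap.
- rewrite pr1_pair, pr1_face; apply pair_uniq; rewrite !compA, compIr.
  + rewrite pr1_pair, <- compA, pr1_cyl_map, compA, pr1_face; apply compIl.
  + rewrite pr2_pair; apply pr2_cyl_map.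
- rewrite pr2_pair, <- compA, pr1_cyl_map, compA.
  unfold face; rewrite !pr2_pair, <- compA; apply f_equal, bang_uniq.
Qed.

Lemma swap_nat (W Z : E) (u : W ~> Z) :
  swap Z ∘ cyl_map (cyl_map u) = cyl_map (cyl_map u) ∘ swap W.
Proof.
apply pair_uniq; rewrite !compA.
- rewrite pr1_cyl_map; unfold swap; rewrite pr1_pair, <- compA, pr1_pair.
  apply pair_uniq; rewrite !compA.
  + rewrite pr1_pair, pr1_cyl_map, <- !compA, pr1_pair, pr1_cyl_map, !compA.
    now rewrite pr1_cyl_map.
  + rewrite pr2_pair, !pr2_cyl_map, pr2_pair; reflexivity.
- rewrite pr2_cyl_map; unfold swap; rewrite !pr2_pair, <- compA.
  now rewrite pr1_cyl_map, compA, pr2_cyl_map.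
Qed.

Lemma pr1_pr1_swap (Z : E) :
  pr1 (cyl Z) ∘ pr1 (cyl (cyl Z)) ∘ swap Z = pr1 (cyl Z) ∘ pr1 (cyl (cyl Z)).
Proof. unfold swap; now rewrite <- compA, !pr1_pair. Qed.

Definition uncurry (Z Y : E) (m : Z ~> path_obj I Y) : cyl Z ~> Y :=
  ev (itv_exp I Y) ∘ cyl_map m.

Lemma uncurry_curry (Z Y : E) (h : cyl Z ~> Y) :
  uncurry (curry (itv_exp I Y) h) = h.
Proof. apply ev_curry. Qed.

Lemma uncurry_inj (Z Y : E) (m m' : Z ~> path_obj I Y) :
  uncurry m = uncurry m' -> m = m'.
Proof. apply curry_uniq. Qed.

Lemma uncurry_comp (W Z Y : E) (m : Z ~> path_obj I Y) (u : W ~> Z) :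
  uncurry (m ∘ u) = uncurry m ∘ cyl_map u.
Proof. unfold uncurry; now rewrite cyl_map_comp, compA. Qed.

Lemma uncurry_path_map (Z Y X : E) (f : Y ~> X) (m : Z ~> path_obj I Y) :
  uncurry (path_map I f ∘ m) = f ∘ uncurry m.
Proof.
unfold uncurry; rewrite cyl_map_comp, compA.
assert (e : ev (itv_exp I X) ∘ cyl_map (path_map I f) = f ∘ ev (itv_exp I Y))
  by exact (ev_curry (itv_exp I X) _).
refine (eq_trans (f_equal (fun k => k ∘ cyl_map m) e) _).
now rewrite <- compA.
Qed.

Lemma uncurry_refl (Z Y : E) (y : Z ~> Y) :
  uncurry (refl I Y ∘ y) = y ∘ pr1 (cyl Z).
Proof.
unfold uncurry, cyl_map, prod_map.
rewrite <- compA.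
exact (ev_refl (y ∘ pr1 (cyl Z)) _).
Qed.

End Cylinders.

Section Endpoints.

Variables (C : category) (FP : finite_products C) (I : interval FP).

(** The endpoint maps are evaluations at the points of the interval.  For
    arbitrary finite products, so that it applies in the slices as well. *)
Lemma exp_pre_point (d : one FP ~> I) (A Z : C) (m : Z ~> path_obj I A) :
  exp_pre d (itv_exp I A) (exp_one FP A) ∘ m =
  ev (itv_exp I A)
    ∘ pair (times FP (itv_exp I A) I) m (d ∘ bang (one FP) Z).
Proof.
unfold exp_pre; cbn.
rewrite <- !compA; apply f_equal.
rewrite compA, prod_map_pair, compIl.
apply pair_uniq; rewrite compA.
- rewrite !pr1_pair; apply compIl.
- rewrite !pr2_pair, <- compA; apply f_equal, bang_uniq.
Qed.

End Endpoints.

Lemma uncurry_face (E : category) (FL : finite_limits E) (I : interval FL)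
    (d : one FL ~> I) (Z Y : E) (m : Z ~> path_obj I Y) :
  uncurry m ∘ face d Z = exp_pre d (itv_exp I Y) (exp_one FL Y) ∘ m.
Proof.
rewrite exp_pre_point; unfold uncurry, cyl_map, face.
rewrite <- compA; apply f_equal.
refine (eq_trans (prod_map_pair FL _ _ _ _) _).
now rewrite compIr, compIl.
Qed.

(** * Lifting of paths, constant on constant paths *)

Lemma pullback_mono (E : category) (X Y Z P : E) (f : X ~> Z) (g : Y ~> Z)
    (p : P ~> X) (q : P ~> Y) :
  is_pullback f g p q -> forall (W : E) (m m' : W ~> P),
    p ∘ m = p ∘ m' -> q ∘ m = q ∘ m' -> m = m'.
Proof.
intros [sq univ] W m m' e1 e2.
destruct (univ W (p ∘ m') (q ∘ m')) as [n [_ hn]].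
{ now rewrite !compA, sq. }
now rewrite <- (hn m (conj e1 e2)), <- (hn m' (conj eq_refl eq_refl)).
Qed.

Section Lifting.

Variables (E : category) (FL : finite_limits E) (I : interval FL).

Local Notation cyl Z := (times FL Z I).

(** Normal lifting in terms of maps out of cylinders.  A section [l] of the
    comparison map lifts all paths at once and so does it naturally in the
    parameter; the naturality that is needed amounts to keeping the lift constant
    on a chosen [u : W ~> Z] over which the path is constant.  In this form the
    property mentions no chosen exponential or pullback. *)
Definition relative_lifting (Y X : E) (f : Y ~> X) : Prop :=
  forall (W Z : E) (u : W ~> Z) (g : cyl Z ~> X) (y : Z ~> Y),
    g ∘ face (d0 I) Z = f ∘ y ->
    g ∘ cyl_map I u = f ∘ y ∘ u ∘ pr1 (cyl W) ->
    exists L : cyl Z ~> Y,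
      f ∘ L = g /\
      L ∘ face (d0 I) Z = y /\
      L ∘ cyl_map I u = y ∘ u ∘ pr1 (cyl W).

(** The lift is the pullback of the universal one along the map [z] classifying the
    path and its starting point.  On [W], the map [z] factors through the constant
    paths, where [l] is constant by normality. *)
Lemma normal_relative_lifting (Y X : E) (f : Y ~> X) :
  normal_hurewicz_fibration I f -> relative_lifting f.
Proof.
intros [l [hl hn]] W Z u g y e0 eu.
assert (e : eps0 I X ∘ curry (itv_exp I X) g = f ∘ y).
{ rewrite <- e0.
  refine (eq_trans (eq_sym (uncurry_face _ _)) _).
  now rewrite uncurry_curry. }
set (z := pb_pair (path_cocyl I f) e).
assert (hz : path_compar I f ∘ (l ∘ z) = z)
  by (rewrite compA, hl; apply compIl).
exists (uncurry (l ∘ z)); split; [|split].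
- rewrite <- uncurry_path_map.
  assert (h1 : path_map I f ∘ (l ∘ z) = curry (itv_exp I X) g).
  { apply (f_equal (comp (pb1 (path_cocyl I f)))) in hz.
    unfold path_compar in hz; rewrite compA, pb1_pair in hz.
    exact (eq_trans hz (pb1_pair _ e)). }
  rewrite h1; apply uncurry_curry.
- rewrite uncurry_face.
  apply (f_equal (comp (pb2 (path_cocyl I f)))) in hz.
  unfold path_compar in hz; rewrite compA, pb2_pair in hz.
  exact (eq_trans hz (pb2_pair _ e)).
- rewrite <- uncurry_comp, <- compA.
  assert (ex : idm X ∘ (f ∘ (y ∘ u)) = f ∘ (y ∘ u)) by apply compIl.
  assert (h2 : z ∘ u = refl_times I f ∘ pb_pair (pb FL (idm X) f) ex).
  { unfold z, refl_times; apply (pb_uniq (p := path_cocyl I f)); rewrite !compA.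
    - rewrite !pb1_pair, <- compA, pb1_pair.
      apply uncurry_inj.
      rewrite uncurry_comp, uncurry_curry, uncurry_refl, eu.
      now rewrite !compA.
    - now rewrite !pb2_pair. }
  rewrite h2, compA, hn, <- compA, pb2_pair; apply uncurry_refl.
Qed.

(** Lift in [T'], then use the universal property: both [g] and the lift are
    constant on [W], hence so is the induced map. *)
Lemma relative_lifting_pullback (Y X T' T : E) (f : Y ~> X) (t : T' ~> T)
    (b : X ~> T) (q : Y ~> T') :
  is_pullback b t f q -> relative_lifting t -> relative_lifting f.
Proof.
intros hp ht W Z u g y e0 eu; assert (sq := proj1 hp).
destruct (ht W Z u (b ∘ g) (q ∘ y)) as [M [hM [hM0 hMu]]].
- now rewrite <- compA, e0, !compA, sq.
- now rewrite <- compA, eu, !compA, sq.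
- destruct (proj2 hp _ _ _ (eq_sym hM)) as [L [[hf hq] _]].
  exists L; split; [exact hf|split]; apply (pullback_mono hp); rewrite compA.
  + now rewrite hf.
  + now rewrite hq.
  + now rewrite hf, eu, !compA.
  + now rewrite hq, hMu, !compA.
Qed.

End Lifting.

(** * Relative paths as fiberwise homotopies *)

Section RelativePaths.

Variables (E : category) (FL : finite_limits E) (I : interval FL).
Variables (A X : E) (a : A ~> X).

Local Notation cyl Z := (times FL Z I).

Let P : pullback (path_map I a) (refl I X) := pb FL (path_map I a) (refl I X).

(** A map into the pathobject over [X] is the same as a map from the cylinder to [A]
    whose composite with [a] is constant along the interval
    ([rel_uncurry_inj], [rel_uncurry_vertical], [rel_uncurry_surj]).  All
    later arguments are made with such maps. *)
Definition rel_uncurry (Z : E) (m : Z ~> rel_path I a) : cyl Z ~> A :=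
  uncurry (pb1 P ∘ m).

Lemma rel_uncurry_comp (W Z : E) (m : Z ~> rel_path I a) (u : W ~> Z) :
  rel_uncurry (m ∘ u) = rel_uncurry m ∘ cyl_map I u.
Proof. unfold rel_uncurry; now rewrite compA, uncurry_comp. Qed.

Lemma rel_uncurry_vertical (Z : E) (m : Z ~> rel_path I a) :
  a ∘ rel_uncurry m = pb2 P ∘ m ∘ pr1 (cyl Z).
Proof.
unfold rel_uncurry; rewrite <- uncurry_path_map, compA, (pb_eq P), <- compA.
apply uncurry_refl.
Qed.

(** The component in [X] is recovered from the values, at the point [d0]. *)
Lemma rel_uncurry_inj (Z : E) (m m' : Z ~> rel_path I a) :
  rel_uncurry m = rel_uncurry m' -> m = m'.
Proof.
intro e; apply (pb_uniq (p := P)).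
- now apply uncurry_inj.
- apply (f_equal (fun k => a ∘ k ∘ face (d0 I) Z)) in e; revert e.
  now rewrite !rel_uncurry_vertical, <- !compA, pr1_face, !compIr.
Qed.

Lemma rel_uncurry_surj (Z : E) (h : cyl Z ~> A) (x : Z ~> X) :
  a ∘ h = x ∘ pr1 (cyl Z) -> exists m : Z ~> rel_path I a, rel_uncurry m = h.
Proof.
intro e.
assert (e' : path_map I a ∘ curry (itv_exp I A) h = refl I X ∘ x).
{ apply uncurry_inj; now rewrite uncurry_path_map, uncurry_curry, uncurry_refl. }
exists (pb_pair P e'); unfold rel_uncurry; rewrite pb1_pair; apply uncurry_curry.
Qed.

(** The endpoint maps of the slice are evaluations at the ends of the cylinder
    formed in [E]; this is where the exponential of the slice is unfolded. *)
Lemma exp_pre_slice_point (d : one FL ~> I) (Z : E) (m : Z ~> rel_path I a) :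
  sl_fun (exp_pre (slice_point X d) (itv_exp (slice_interval I X) (SliceOb a))
            (exp_one (slice_products FL X) (SliceOb a))) ∘ m =
  rel_uncurry m ∘ face d Z.
Proof.
set (S := slice_interval I X).
set (Z' := SliceOb (pb2 P ∘ m) : slice X).
set (m' := @SliceHom E X Z' (path_obj S (SliceOb a)) m eq_refl).
assert (e := f_equal (@sl_fun _ _ _ _)
  (exp_pre_point (I := S) (slice_point X d : one (slice_products FL X) ~> S) m')).
refine (eq_trans e _).
unfold rel_uncurry; rewrite uncurry_face, exp_pre_point.
cbn; unfold slice_ev_fun; cbn.
rewrite <- compA; apply f_equal.
apply pair_uniq; rewrite compA.
- rewrite !pr1_pair, <- compA, pb1_pair; reflexivity.
- rewrite !pr2_pair, <- compA, pb2_pair.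
  rewrite compA, pr2_pair, <- compA; apply f_equal, bang_uniq.
Qed.

Lemma pb1_rel_endpoints (Z : E) (m : Z ~> rel_path I a) :
  pb1 (pb FL a a) ∘ rel_endpoints I a ∘ m = rel_uncurry m ∘ face (d0 I) Z.
Proof.
rewrite <- exp_pre_slice_point.
apply (f_equal (fun k => k ∘ m)); cbn; apply pb1_pair.
Qed.

Lemma pb2_rel_endpoints (Z : E) (m : Z ~> rel_path I a) :
  pb2 (pb FL a a) ∘ rel_endpoints I a ∘ m = rel_uncurry m ∘ face (d1 I) Z.
Proof.
rewrite <- exp_pre_slice_point.
apply (f_equal (fun k => k ∘ m)); cbn; apply pb2_pair.
Qed.

(** The adjunction equation of the slice, transported from the cylinder in the slice
    to the one in [E] along [slice_transpose]. *)
Lemma rel_uncurry_refl : rel_uncurry (rel_refl I a) = pr1 (cyl A).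
Proof.
set (S := slice_interval I X).
set (A' := SliceOb a : slice X).
assert (e : ev (itv_exp S A') ∘ prod_map (slice_products FL X) (refl S A') (idm S)
            = pr1 (times (slice_products FL X) A' (one (slice_products FL X)))
              ∘ prod_map (slice_products FL X) (idm A')
                  (bang (one (slice_products FL X)) S))
  by exact (ev_curry (itv_exp S A') _).
apply (f_equal (fun k : slice_hom (slice_prod_obj FL A' (slice_itv_obj I X)) A' =>
  sl_fun k ∘ slice_transpose I A')) in e.
assert (e' := slice_ev_prod_map (refl S A')).
refine (eq_trans _ (eq_trans e _)).
- refine (eq_trans _ (eq_sym (f_equal (fun k => k ∘ slice_transpose I A') e'))).
  rewrite <- compA, slice_transpose_retraction, compIr; reflexivity.
- cbn; rewrite pb1_pair, compIl; unfold slice_transpose; apply pb1_pair.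
Qed.

Lemma rel_endpoints_refl : rel_endpoints I a ∘ rel_refl I a = rel_diag FL a.
Proof.
unfold rel_diag; apply (pb_uniq (p := pb FL a a)); rewrite compA.
- rewrite pb1_rel_endpoints, rel_uncurry_refl, pb1_pair; apply pr1_face.
- rewrite pb2_rel_endpoints, rel_uncurry_refl, pb2_pair; apply pr1_face.
Qed.

End RelativePaths.

(** * Endpoint maps of classified maps are classified *)

Section PathTypes.

Variables (E : category) (FL : finite_limits E) (I : interval FL).

Local Notation cyl Z := (times FL Z I).

(** If [p] is the pullback of [t] along [b] then its fibers are fibers of [t], and a
    path in a fiber of [p] is a path in the corresponding fiber of [t].  Hence the
    endpoint map of [p] is the pullback of that of [t] along the induced [qq], and
    pasting with the path-type square classifies it. *)
Lemma classified_rel_endpoints (t : natural_model E) (A X : E) (p : A ~> X) :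
  has_path_types I t -> classified t p -> classified t (rel_endpoints I p).
Proof.
intros [Path [path hpath]] [b [q hp]].
assert (sq := proj1 hp).
assert (eqq : nm_map t ∘ (q ∘ pb1 (pb FL p p)) = nm_map t ∘ (q ∘ pb2 (pb FL p p))).
{ now rewrite !compA, <- sq, <- !compA, (pb_eq (pb FL p p)). }
set (qq := pb_pair (pb FL (nm_map t) (nm_map t)) eqq).
destruct (@rel_uncurry_surj E FL I _ _ (nm_map t) _
  (q ∘ rel_uncurry (idm (rel_path I p))) (b ∘ pb2 (pb FL (path_map I p) (refl I X))))
  as [Pq hPq].
{ rewrite compA, <- sq, <- compA, rel_uncurry_vertical, !compA.
  now rewrite compIr. }
assert (hPqm : forall (W : E) (m : W ~> rel_path I p),
  rel_uncurry (Pq ∘ m) = q ∘ rel_uncurry m).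
{ intros W m; rewrite rel_uncurry_comp, hPq, <- compA, <- rel_uncurry_comp.
  now rewrite compIl. }
assert (hends : rel_endpoints I (nm_map t) ∘ Pq = qq ∘ rel_endpoints I p).
{ unfold qq; apply (pb_uniq (p := pb FL (nm_map t) (nm_map t))); rewrite !compA.
  - rewrite pb1_rel_endpoints, pb1_pair, hPq, <- !compA, <- pb1_rel_endpoints.
    now rewrite compIr.
  - rewrite pb2_rel_endpoints, pb2_pair, hPq, <- !compA, <- pb2_rel_endpoints.
    now rewrite compIr. }
exists (Path ∘ qq), (path ∘ Pq); split.
{ now rewrite <- compA, <- hends, !compA, (proj1 hpath). }
intros W h k e.
destruct (proj2 hpath W (qq ∘ h) k) as [n [[hn1 hn2] hnu]].
{ now rewrite compA. }
(* The path [n] lies in the fiber of [t] over [b ∘ x], which is that of [p] over [x]. *)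
set (x := p ∘ (pb1 (pb FL p p) ∘ h)).
assert (hx2 : p ∘ (pb2 (pb FL p p) ∘ h) = x)
  by (unfold x; now rewrite !compA, (pb_eq (pb FL p p))).
assert (n0 : rel_uncurry n ∘ face (d0 I) W = q ∘ (pb1 (pb FL p p) ∘ h)).
{ rewrite <- pb1_rel_endpoints, <- compA, hn1; unfold qq.
  now rewrite compA, pb1_pair, compA. }
assert (n1 : rel_uncurry n ∘ face (d1 I) W = q ∘ (pb2 (pb FL p p) ∘ h)).
{ rewrite <- pb2_rel_endpoints, <- compA, hn1; unfold qq.
  now rewrite compA, pb2_pair, compA. }
assert (nv : b ∘ (x ∘ pr1 (cyl W)) = nm_map t ∘ rel_uncurry n).
{ assert (v := rel_uncurry_vertical n).
  rewrite v; apply (f_equal (fun k => k ∘ face (d0 I) W)) in v; revert v.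
  rewrite <- !compA, pr1_face, compIr, n0, (compA (nm_map t)), <- sq.
  intro v; unfold x.
  rewrite !compA in v; rewrite !compA.
  now rewrite v. }
destruct (proj2 hp _ _ _ nv) as [h' [[hh1 hh2] _]].
destruct (rel_uncurry_surj hh1) as [m hm].
assert (me : rel_endpoints I p ∘ m = h).
{ apply (pb_uniq (p := pb FL p p)); rewrite compA.
  - rewrite pb1_rel_endpoints, hm.
    apply (pullback_mono hp); rewrite compA.
    + rewrite hh1, <- compA, pr1_face; apply compIr.
    + rewrite hh2; exact n0.
  - rewrite pb2_rel_endpoints, hm.
    apply (pullback_mono hp); rewrite compA.
    + rewrite hh1, <- compA, pr1_face, hx2; apply compIr.
    + rewrite hh2; exact n1. }
exists m; split; [split; [exact me|]|].
- assert (en : Pq ∘ m = n)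
    by (apply rel_uncurry_inj; now rewrite hPqm, hm).
  now rewrite <- compA, en.
- intros m' [me' mk'].
  apply rel_uncurry_inj, (pullback_mono hp).
  + rewrite hm, hh1, rel_uncurry_vertical; unfold x.
    apply (f_equal (fun k => k ∘ pr1 (cyl W))).
    rewrite <- me', (compA _ (rel_endpoints I p)), pb1_rel_endpoints, compA.
    now rewrite rel_uncurry_vertical, <- compA, pr1_face, compIr.
  + rewrite hm, hh2, <- hPqm.
    apply f_equal, hnu; split.
    * now rewrite compA, hends, <- compA, me'.
    * now rewrite compA.
Qed.

End PathTypes.

(** * Contraction of paths and elimination *)

Section Contraction.

Variables (E : category) (FL : finite_limits E) (I : interval FL).
Variables (A X : E) (p : A ~> X).

Local Notation cyl Z := (times FL Z I).
Local Notation P := (rel_path I p).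

Definition source : P ~> A := pb1 (pb FL p p) ∘ rel_endpoints I p.

Lemma source_eq : source = rel_uncurry (idm P) ∘ face (d0 I) P.
Proof. unfold source; rewrite <- pb1_rel_endpoints; symmetry; apply compIr. Qed.

Lemma source_refl : source ∘ rel_refl I p = idm A.
Proof.
unfold source; rewrite <- compA, rel_endpoints_refl; apply pb1_pair.
Qed.

Lemma rel_uncurry_refl_comp (Z : E) (z : Z ~> A) :
  rel_uncurry (rel_refl I p ∘ z) = z ∘ pr1 (cyl Z).
Proof. rewrite rel_uncurry_comp, rel_uncurry_refl; apply pr1_cyl_map. Qed.

(** The contraction of a path onto the constant path at its source: the transpose
    of a lift of [i |-> (x, e i)] through the endpoint map. *)
Lemma contraction :
  relative_lifting I (rel_endpoints I p) ->
  exists K : cyl P ~> P,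
    K ∘ face (d0 I) P = rel_refl I p ∘ source /\
    K ∘ face (d1 I) P = idm P /\
    K ∘ cyl_map I (rel_refl I p) = rel_refl I p ∘ pr1 (cyl A).
Proof.
intro lift.
set (e := rel_uncurry (idm P)).
set (base := pb2 (pb FL (path_map I p) (refl I X))).
assert (ve : p ∘ e = base ∘ pr1 (cyl P)).
{ unfold e; rewrite rel_uncurry_vertical; unfold base; now rewrite compIr. }
assert (vs : p ∘ source = base).
{ rewrite source_eq, compA; fold e.
  rewrite ve, <- compA, pr1_face; apply compIr. }
assert (ee : e ∘ cyl_map I (rel_refl I p) = pr1 (cyl A)).
{ unfold e; rewrite <- rel_uncurry_comp, compIl; apply rel_uncurry_refl. }
assert (eg : p ∘ (source ∘ pr1 (cyl P)) = p ∘ e)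
  by now rewrite compA, vs, ve.
(* [g] is the path [i |-> (x, e i)], for the universal path [e] and its source [x]. *)
set (g := pb_pair (pb FL p p) eg).
destruct (lift A P (rel_refl I p) g (rel_refl I p ∘ source))
  as [L [hL [hL0 hLr]]].
- rewrite compA, rel_endpoints_refl; unfold g, rel_diag.
  apply (pb_uniq (p := pb FL p p)); rewrite !compA.
  + now rewrite !pb1_pair, <- compA, pr1_face, compIr, compIl.
  + rewrite !pb2_pair, compIl; symmetry; apply source_eq.
- rewrite compA, rel_endpoints_refl.
  rewrite <- (compA _ source), source_refl, compIr; unfold g, rel_diag.
  apply (pb_uniq (p := pb FL p p)); rewrite !compA.
  + rewrite !pb1_pair, <- compA, pr1_cyl_map, compA, source_refl; reflexivity.
  + rewrite !pb2_pair, ee, compIl; reflexivity.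
- rewrite <- (compA _ source), source_refl, compIr in hLr.
  assert (sv : p ∘ rel_uncurry L = base ∘ pr1 (cyl P) ∘ pr1 (cyl (cyl P))).
  { rewrite rel_uncurry_vertical; apply (f_equal (fun k => k ∘ pr1 (cyl (cyl P)))).
    fold base; rewrite <- vs; unfold source at 1.
    rewrite <- !compA, hL; unfold g; now rewrite pb1_pair. }
  destruct (@rel_uncurry_surj E FL I _ _ p _ (rel_uncurry L ∘ swap I P) (base ∘ pr1 (cyl P)))
    as [K hK].
  { now rewrite compA, sv, <- !compA, (compA (pr1 (cyl P))), pr1_pr1_swap. }
  assert (hKf : forall d, rel_uncurry (K ∘ face d P) = rel_uncurry L ∘ face d (cyl P)).
  { intro d; now rewrite rel_uncurry_comp, hK, <- compA, swap_cyl_map_face. }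
  (* The ends of [K] are the rows [s - 0] and [s - 1] of the square, that is, the
     endpoints of the paths [s i -], which are given by [g]. *)
  exists K; split; [|split]; apply rel_uncurry_inj.
  + rewrite hKf, <- pb1_rel_endpoints, <- compA, hL; unfold g; rewrite pb1_pair.
    symmetry; apply rel_uncurry_refl_comp.
  + rewrite hKf, <- pb2_rel_endpoints, <- compA, hL; unfold g; apply pb2_pair.
  + rewrite rel_uncurry_comp, hK, <- compA, swap_nat, compA, <- rel_uncurry_comp, hLr.
    rewrite rel_uncurry_refl_comp; apply pr1_pr1_swap.
Qed.

(** Transport along the contraction, from [c] at the source. *)
Lemma relative_elimination :
  relative_lifting I (rel_endpoints I p) ->
  forall (C : E) (pi : C ~> P) (c : A ~> C),
    relative_lifting I pi -> pi ∘ c = rel_refl I p ->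
    exists j : P ~> C, pi ∘ j = idm P /\ j ∘ rel_refl I p = c.
Proof.
intros lift C pi c liftpi hc.
destruct (contraction lift) as [K [hK0 [hK1 hKr]]].
destruct (liftpi A P (rel_refl I p) K (c ∘ source)) as [M [hM [_ hMr]]].
- now rewrite compA, hc.
- rewrite compA, hc, <- (compA _ source), source_refl, compIr; exact hKr.
- exists (M ∘ face (d1 I) P); split.
  + now rewrite compA, hM.
  + rewrite <- compA, <- face_nat, compA, hMr.
    rewrite <- (compA c), source_refl, compIr, <- compA, pr1_face; apply compIr.
Qed.

End Contraction.

Theorem proposition2p7 (E : category) (FL : finite_limits E) (I : interval FL)
    (t : natural_model E)
    (A1 : has_path_types I t)
    (A2 : normal_hurewicz_fibration I (nm_map t))
    (A X : E) (p : Hom A X) (Hp : classified t p) :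
  (classified t (rel_endpoints I p) /\
   comp (rel_endpoints I p) (rel_refl I p) = rel_diag FL p) /\
  (forall (C : E) (pi : Hom C (rel_path I p)) (c : Hom A C),
     classified t pi ->
     comp pi c = rel_refl I p ->
     exists j : Hom (rel_path I p) C,
       comp pi j = idm (rel_path I p) /\ comp j (rel_refl I p) = c).
Proof.
assert (lift : forall (B Y : E) (f : B ~> Y), classified t f -> relative_lifting I f).
{ intros B Y f [b [q hf]].
  exact (relative_lifting_pullback hf (normal_relative_lifting A2)). }
assert (He := classified_rel_endpoints A1 Hp).
split; [exact (conj He (rel_endpoints_refl I p))|].
intros C pi c Hpi; exact (relative_elimination (lift _ _ _ He) (lift _ _ _ Hpi)).
Qed.
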